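(* Let $M\subset\mathbb R^{n+1}$ be the $n$-dimensional Cayley hypersurface, i.e. the graph of $$F(x_1,\dots,x_n)=\sum_{d=2}^{n+1}\frac{(-1)^d}{d}\sum_{i_1+\dots+i_d=n+1}\ \prod_{j=1}^dx_{i_j},$$ with transversal vector field $\xi=(\mathbf 0,1)$. Then the metrised Jordan algebra $(J,\gamma)$ defined by $M$ can be described as follows: $J$ is the polynomial quotient ring $(t\mathbb R[t])/(t^{n+1})$, and for two polynomials $p,q\in t\mathbb R[t]$ with equivalence classes $[p],[q]\in J$, $\gamma([p],[q])$ is the coefficient at $t^{n+1}$ of the product $p\cdot q$.
   Context: In the definition of $F$ the inner sum runs over all ordered $d$-tuples $(i_1,\dots,i_d)$ of positive integers with sum $n+1$ (all permutations counted). Here $(t^{n+1})=t^{n+1}\mathbb R[t]$. For a graph immersion $x\mapsto(x,F(x))$ with transversal field $\xi=(\mathbf 0,1)$, let $h=F''$ (affine fundamental form), $\nabla$ the flat connection of $\mathbb R^n$, $\hat\nabla$ the Levi-Civita connection of $h$, $C=\nabla h=F'''$ the cubic form, and $K=\nabla-\hat\nabla$, i.e. $K^\gamma_{\alpha\beta}=-\frac12F_{,\alpha\beta\delta}F^{,\gamma\delta}$ (indices after a comma denote partial derivatives, $F^{,\gamma\delta}$ is the inverse Hessian). If $\hat\nabla C=0$ (which is the case for Cayley hypersurfaces), then at any point $y$ the tangent space with product $u\bullet v=K(u,v)$ is a Jordan algebra $J$ and $\gamma=h_y$ is a non-degenerate trace form on it, i.e. $\gamma(u\bullet v,w)=\gamma(u,v\bullet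 w)$; $(J,\gamma)$ is the metrised Jordan algebra defined by the immersion. For the Cayley hypersurface its isomorphism class does not depend on the point $y$ (one may take $y=\mathbf 0$). *)

(* Defs.v *)
From HB Require Import structures.
From mathcomp Require Import all_boot all_order all_algebra.
From mathcomp Require Import all_classical all_reals all_analysis.
Import numFieldNormedType.Exports.

Set Implicit Arguments.
Unset Strict Implicit.
Unset Printing Implicit Defensive.

Import Order.TTheory GRing.Theory Num.Theory.
Local Open Scope ring_scope.

Section GraphImmersion.
Variables (R : realType) (n : nat).

(* 'D_v is the directional derivative of the library, which is a total operator
   with a junk value at points where the limit does not exist; it is only
   applied below to polynomial functions. *)
Definition partial (i : 'I_n) (f : 'rV[R]_n -> R) : 'rV[R]_n -> R :=
  fun x => 'D_(delta_mx 0 i) f x.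

Variable F : 'rV[R]_n -> R.

(* For the graph of F with transversal field (0, 1), the affine fundamental
   form is F'' in the global chart x |-> (x, F x), whose tangent spaces are all
   identified with R^n. *)
Definition affine_form_mx (y : 'rV[R]_n) : 'M[R]_n :=
  \matrix_(i, j) partial j (partial i F) y.

Definition affine_form (y u v : 'rV[R]_n) : R :=
  \sum_(i < n) \sum_(j < n) affine_form_mx y i j * u 0 i * v 0 j.

Definition cubic_form (y : 'rV[R]_n) (i j k : 'I_n) : R :=
  partial k (partial j (partial i F)) y.

(* K^c_{ab} = - 1/2 F_{,abd} F^{,cd}: the flat connection minus the Levi-Civita
   connection of F''. *)
Definition difference_coef (y : 'rV[R]_n) (c a b : 'I_n) : R :=
  - 2^-1 * \sum_(d < n) cubic_form y a b d * invmx (affine_form_mx y) c d.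

Definition difference_tensor (y u v : 'rV[R]_n) : 'rV[R]_n :=
  \row_c \sum_(a < n) \sum_(b < n) difference_coef y c a b * u 0 a * v 0 b.

End GraphImmersion.

(* Coordinates are numbered from 0 in 'I_n, so the paper's index i_j is
   (i j).+1.  A d-tuple of positive integers of sum n + 1 with d >= 2 has all
   its entries <= n, so letting i range over functions into 'I_n loses none. *)
Definition cayley_function (R : realType) (n : nat) (x : 'rV[R]_n) : R :=
  \sum_(2 <= d < n.+2) (-1) ^+ d / d%:R *
    \sum_(i : {ffun 'I_d -> 'I_n} | (\sum_(j < d) (i j).+1 == n.+1)%N)
      \prod_(j < d) x 0 (i j).

Record metrised_jordan_algebra (R : comNzRingType) (V : lmodType R)
    (mul : V -> V -> V) (g : V -> V -> R) : Prop := MetrisedJordanAlgebra {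
  mj_mul_linear : forall u, linear (mul u);
  mj_mul_comm : commutative mul;
  mj_jordan : forall u v,
    mul (mul u u) (mul v u) = mul (mul (mul u u) v) u;
  mj_form_linear : forall u, scalar (g u);
  mj_form_sym : forall u v, g u v = g v u;
  mj_form_nondegenerate : forall u, (forall v, g u v = 0) -> u = 0;
  mj_form_trace : forall u v w, g (mul u v) w = g u (mul v w)
}.

(* tR[t] is the ideal of polynomials divisible by 'X, and [p] is the class of p
   in R[t]/(t^{n+1}) = {poly %/ 'X^(n.+1)}.  The ring tR[t]/(t^{n+1}) is realised
   as the image of tR[t] in this quotient. *)
Definition tpoly_class (R : realType) (n : nat) (p : {poly R}) :
    {poly %/ ('X^(n.+1) : {poly R})} :=
  in_qpoly ('X^(n.+1)) p.

Definition in_tquotient (R : realType) (n : nat)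
    (z : {poly %/ ('X^(n.+1) : {poly R})}) : Prop :=
  exists2 p : {poly R}, 'X %| p & z = tpoly_class n p.

(* Main.v *)
Require Import Defs.
From HB Require Import structures.
From mathcomp Require Import all_boot all_order all_algebra.
From mathcomp Require Import all_classical all_reals all_analysis.
From mathcomp Require Import ring.
Import numFieldNormedType.Exports.
Import Order.TTheory GRing.Theory Num.Theory.
Local Open Scope ring_scope.

(* Write X(t) = sum_i x_i t^i.  Then F(x) is minus the coefficient of t^(n+1) in
   log (1 + X), so F_{,ab} and F_{,abc} are the coefficients of t^(n+1) in
   t^(a+b) / (1 + X)^2 and -2 t^(a+b+c) / (1 + X)^3.  Identifying a tangent
   vector u with U(t) = sum_i u_i t^i, the form gamma(u, v) is thus the
   coefficient of U V / (1 + X)^2, and K(u, v) is U V / (1 + X) mod t^(n+1).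
   Hence u |-> U / (1 + X) mod t^(n+1) is the isomorphism sought.  Power series
   in X are replaced by truncations: [log_poly n] stands for s - log (1 + s),
   [geom_poly n] for 1 / (1 + s). *)

Set Implicit Arguments.
Unset Strict Implicit.
Unset Printing Implicit Defensive.

(** * Congruences of polynomials modulo powers of t *)

Section PolyModXn.
Variable R : fieldType.
Implicit Types p q g : {poly R}.

Lemma dvdpXnP m p : reflect (forall i, (i < m)%N -> p`_i = 0) ('X^m %| p).
Proof.
apply: (iffP (Pdiv.CommonIdomain.modp_eq0P _ _)) => [+ i lt_im|p0].
  rewrite -Pdiv.IdomainMonic.take_poly_modp => /(congr1 (fun r : {poly R} => r`_i)).
  by rewrite coef_take_poly lt_im coef0.
apply/polyP => i.
rewrite -Pdiv.IdomainMonic.take_poly_modp coef_take_poly coef0.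
by case: ifP => // /p0.
Qed.

Lemma dvdpX_coef0 p : 'X %| p -> p`_0 = 0.
Proof. by rewrite -['X]expr1 => /dvdpXnP; apply. Qed.

Lemma coef_eq_mod m p q i :
  'X^m %| p - q -> (i < m)%N -> p`_i = q`_i.
Proof.
by move=> /dvdpXnP pq0 /pq0 /eqP; rewrite coefB subr_eq0 => /eqP.
Qed.

Lemma in_qpolyXn_eq m p q :
  in_qpoly 'X^(m.+1) p = in_qpoly 'X^(m.+1) q <-> 'X^(m.+1) %| p - q.
Proof.
have rE r : Pdiv.CommonRing.rmodp r (qpoly.mk_monic 'X^(m.+1)) = take_poly m.+1 r.
  by rewrite qpoly.mk_monic_Xn -Pdiv.RingMonic.take_poly_rmodp.
split=> [/(congr1 (@qpoly.polyn _ _))|/dvdpXnP pq0] /=.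
  rewrite !rE => e; apply/dvdpXnP => i lt_im.
  move/(congr1 (fun r : {poly R} => r`_i)): e.
  by rewrite !coef_take_poly lt_im coefB => ->; rewrite subrr.
apply: val_inj; rewrite /= !rE; apply/polyP => i; rewrite !coef_take_poly.
by case: ifP => // /pq0 /eqP; rewrite coefB subr_eq0 => /eqP.
Qed.

Lemma dvdp_Xn_deriv m p : 'X^(m.+1) %| p -> 'X^m %| p^`().
Proof.
move=> /dvdpXnP p0; apply/dvdpXnP => i lt_im.
by rewrite coef_deriv p0 // mul0rn.
Qed.

Lemma dvdp_Xn_comp m p q : 'X^m %| p -> 'X %| q -> 'X^m %| p \Po q.
Proof.
move=> p0 q0; apply: dvdp_trans (dvdp_comp_poly q p0).
by rewrite rmorphXn /= comp_polyX dvdp_exp2r.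
Qed.

(** The summands have the shape that differentiating powers of [tpoly] produces. At [i = 0] the
    truncated exponent [i.-1] is harmless, being killed by [*+ 0]. *)
Lemma comp_deriv_polyE g q :
  g^`() \Po q = \sum_(i < size g) g`_i *: (q ^+ i.-1 *+ i).
Proof.
rewrite -[in LHS](coefK g) poly_def raddf_sum /= raddf_sum /=.
apply: eq_bigr => i _.
by rewrite derivZ derivXn comp_polyZ raddfMn /= rmorphXn /= comp_polyX.
Qed.

End PolyModXn.

(** * Truncations of s - log (1 + s) and 1 / (1 + s) *)

Section GeneratingPolynomials.
Variables (R : numFieldType) (n : nat).

Definition log_poly : {poly R} :=
  \sum_(2 <= d < n.+2) ((-1) ^+ d / d%:R) *: 'X^d.

Definition geom_poly : {poly R} := \sum_(k < n.+1) (- 'X) ^+ k.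

(** An exact equality: the truncation degrees n + 1 and n match, and starting at d = 2 removes the
    constant term of the geometric sum. *)
Lemma deriv_log_poly : log_poly^`() = 1 - geom_poly.
Proof.
rewrite /geom_poly big_ord_recl expr0 opprD addrA subrr add0r.
rewrite /log_poly raddf_sum /= big_add1 /= big_add1 /= big_mkord -sumrN.
apply: eq_bigr => k _; rewrite derivZ derivXn -scalerMnr scalerMnl -mulr_natr.
rewrite divfK ?pnatr_eq0 // exprS mulN1r scaleNr /bump /= add1n.
by rewrite [(- 'X) ^+ _]exprNn -mul_polyC rmorphXn rmorphN1.
Qed.

Lemma geom_polyM : geom_poly * (1 + 'X) = 1 - (- 'X) ^+ n.+1.
Proof.
have := subrX1 (- 'X : {poly R}) n.+1; rewrite -/geom_poly => e.
by rewrite -[RHS]opprB e -mulNr opprD !opprK addrC mulrC addrC.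
Qed.

Lemma deriv_geom_poly : 'X^n %| geom_poly^`() + geom_poly ^+ 2.
Proof.
have eM := geom_polyM; have := congr1 deriv eM.
rewrite exprS in eM.
rewrite derivM derivB !derivC derivD derivC derivX deriv_exp !add0r mulr1.
rewrite derivN derivX /= -mulr_natl => eD.
have -> : geom_poly^`() + geom_poly ^+ 2 =
    (geom_poly * n.+1%:R - geom_poly^`() * 'X) * (- 'X) ^+ n.
  (* Both brackets are truncation errors: the first is the derivative of [geom_polyM], the second is
     [geom_polyM] itself. *)
  transitivity (geom_poly * (geom_poly^`() * (1 + 'X) + geom_poly)
    + geom_poly^`() * (1 - geom_poly * (1 + 'X))); first by ring.
  by rewrite eD eM; ring.
by rewrite [(- 'X) ^+ n]exprNn mulrA dvdp_mull.
Qed.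

Lemma log_poly_deriv2 : 'X^n %| log_poly^`()^`() - geom_poly ^+ 2.
Proof.
rewrite deriv_log_poly derivB derivC sub0r -opprD dvdpNr.
exact: deriv_geom_poly.
Qed.

(** Differentiating the congruence for the second derivative costs one order; then g' is replaced by
    - g^2. *)
Lemma log_poly_deriv3 : 'X^(n.-1) %| log_poly^`()^`()^`() + 2 * geom_poly ^+ 3.
Proof.
have := log_poly_deriv2; have := deriv_geom_poly.
case: n => [|m] D1 D2; first by rewrite dvd1p.
have := dvdp_Xn_deriv D2.
rewrite derivB deriv_exp /= expr1 => D3.
rewrite (_ : _ + _ = log_poly^`()^`()^`() - geom_poly^`() * geom_poly *+ 2
    + 2 * geom_poly * (geom_poly^`() + geom_poly ^+ 2)); last by ring.
by rewrite dvdp_addr // dvdp_mull // (dvdp_trans _ D1) // dvdp_exp2l.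
Qed.

End GeneratingPolynomials.

(** * Derivatives of coefficients of polynomials in X(t) *)

Section TPolyDerivatives.
Variables (R : realType) (n : nat).
Implicit Types (u v x y : 'rV[R]_n) (p q g : {poly R}).

Definition tpoly u : {poly R} := \sum_(i < n) u 0 i *: 'X^(i.+1).

Lemma is_derive_coord x v (i : 'I_n) :
  is_derive x v (fun y : 'rV[R]_n => y 0 i : R) (v 0 i).
Proof.
have E : ((fun h : R =>
    h^-1 *: (((fun y : 'rV[R]_n => y 0 i : R) \o shift x) (h *: v) - x 0 i))
      @ 0^' --> (v 0 i : R))%classic.
  (* The difference quotient is constant for h <> 0. *)
  apply: cvg_near_cst; near=> h.
  rewrite /= !mxE addrK scalerA mulVf ?scale1r //.
  by near: h; exact: nbhs_dnbhs_neq.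
apply: DeriveDef; last exact: cvg_lim E.
by apply/cvg_ex; exists (v 0 i).
Unshelve. all: by end_near.
Qed.

Lemma tpoly_delta (a : 'I_n) : tpoly (delta_mx 0 a) = 'X^(a.+1).
Proof.
rewrite /tpoly (bigD1 a) //= mxE !eqxx scale1r big1 ?addr0 // => i ia.
by rewrite mxE (negPf ia) andbF scale0r.
Qed.

Lemma coef_mul_tpoly (m : nat) p q u :
  (p * tpoly u * q)`_m = \sum_(i < n) u 0 i * (p * 'X^(i.+1) * q)`_m.
Proof.
rewrite [tpoly u]/tpoly mulr_sumr mulr_suml coef_sum.
by apply: eq_bigr => i _; rewrite -scalerAr -scalerAl coefZ.
Qed.

(** Product rule by induction on k. The factor [q] is arbitrary so that it can absorb the monomial
    t^(i+1) split off from one factor X(t). *)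
Lemma is_derive_coef_exp (m k : nat) q x v :
  is_derive x v (fun y => (q * tpoly y ^+ k)`_m)
    (q * tpoly v * (tpoly x ^+ k.-1 *+ k))`_m.
Proof.
elim: k m q => [|k IH] m q.
  rewrite mulr0n mulr0 coef0.
  rewrite (_ : (fun _ => _) = cst (q`_m)); last first.
    by apply/funext => y; rewrite expr0 mulr1.
  exact: is_derive_cst.
rewrite (_ : (fun _ => _) = \sum_(i < n) ((fun y : 'rV[R]_n => y 0 i)
    * (fun y => (q * 'X^(i.+1) * tpoly y ^+ k)`_m))); last first.
  by apply/funext => y; rewrite fct_sumE exprS mulrA coef_mul_tpoly.
apply: (is_derive_eq (is_derive_sum (fun i =>
  is_deriveM (is_derive_coord x v i) (IH m (q * 'X^(i.+1)))))).
rewrite big_split /=.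
transitivity ((q * tpoly x * tpoly v * (tpoly x ^+ k.-1 *+ k))`_m
     + (q * tpoly v * tpoly x ^+ k)`_m).
  congr (_ + _); last first.
    by rewrite coef_mul_tpoly; apply: eq_bigr => i _; exact: mulrC.
  rewrite -[_ * tpoly v * _]mulrA coef_mul_tpoly; apply: eq_bigr => i _.
  by congr (_ * _); rewrite mulrA.
rewrite -coefD; congr (nth 0 (polyseq _) m); case: k {IH} => [|k] /=; first by ring.
by rewrite [tpoly x ^+ k.+1]exprS; ring.
Qed.

Lemma is_derive_coef_comp (m : nat) q g x v :
  is_derive x v (fun y => (q * (g \Po tpoly y))`_m)
    (q * tpoly v * (g^`() \Po tpoly x))`_m.
Proof.
rewrite (_ : (fun _ => _) = \sum_(i < size g)
    (g`_i \*: (fun y => (q * tpoly y ^+ i)`_m))); last first.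
  apply/funext => y; rewrite fct_sumE comp_polyE mulr_sumr coef_sum.
  by apply: eq_bigr => i _; rewrite -scalerAr coefZ.
apply: (is_derive_eq (is_derive_sum (fun i : 'I_(size g) =>
  is_deriveZ g`_i (is_derive_coef_exp m i q x v)))).
rewrite comp_deriv_polyE; move: (q * tpoly v) => c; rewrite mulr_sumr coef_sum.
by apply: eq_bigr => i _; rewrite -scalerAr coefZ.
Qed.

Lemma partial_coef_comp (m : nat) q g (a : 'I_n) :
  partial a (fun y => (q * (g \Po tpoly y))`_m) =
  (fun y => (q * 'X^(a.+1) * (g^`() \Po tpoly y))`_m).
Proof.
apply/funext => x; rewrite -tpoly_delta.
exact: (@derive_val _ _ _ _ _ _ _ (is_derive_coef_comp m q g x (delta_mx 0 a))).
Qed.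

(* The factor 1 is there for [partial_coef_comp] to apply. *)
Lemma cayley_functionE :
  @cayley_function R n = (fun y => (1 * (log_poly R n \Po tpoly y))`_n.+1).
Proof.
apply/funext => y; rewrite mul1r /cayley_function /log_poly raddf_sum coef_sum.
apply: eq_bigr => d _; rewrite /= comp_polyZ coefZ; congr (_ * _).
rewrite rmorphXn /= comp_polyX -[d in RHS]card_ord -prodr_const.
(* The d-th power of X(t) expands over all index functions [f]; reading off the coefficient of
   t^(n+1) selects those with the required sum. *)
rewrite bigA_distr_bigA coef_sum big_mkcond /=; apply: eq_bigr => f _.
rewrite scaler_prod -expr_sum coefZ coefXn eq_sym.
by case: ifP => _; rewrite ?mulr1 ?mulr0.
Qed.

End TPolyDerivatives.

(** * The metrised algebra at a point y and its isomorphism *)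

Section CayleyAlgebra.
Variables (R : realType) (n : nat) (y : 'rV[R]_n).
Implicit Types (u v w : 'rV[R]_n) (p q : {poly R}).
Local Notation F := (@cayley_function R n).

Definition inv_tpoly : {poly R} := geom_poly R n \Po tpoly y.
Local Notation E := inv_tpoly.

(** Inverse of [tpoly] modulo t^(n+1) on multiples of t: the constant term and the terms of degree
    above n are dropped. *)
Definition trep p : 'rV[R]_n := \row_i p`_i.+1.

Lemma tpoly_is_linear : linear (@tpoly R n).
Proof.
move=> a u v; rewrite /tpoly scaler_sumr -big_split /=.
by apply: eq_bigr => i _; rewrite !mxE scalerDl scalerA.
Qed.

HB.instance Definition _ :=
  GRing.isLinear.Build R 'rV[R]_n {poly R} _ (@tpoly R n) tpoly_is_linear.

Lemma dvdpX_tpoly u : 'X %| tpoly u.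
Proof.
apply: (big_ind (fun p => 'X %| p)) => [|p q|i _]; [exact: dvdp0|exact: dvdp_add|].
by rewrite -mul_polyC exprS dvdp_mull ?dvdp_mulr.
Qed.

Lemma coef_tpoly u (i : 'I_n) : (tpoly u)`_i.+1 = u 0 i.
Proof.
rewrite coef_sum (bigD1 i) //= coefZ coefXn eqxx mulr1 big1 ?addr0 // => j ji.
by rewrite coefZ coefXn eqSS eq_sym (negPf (ji : val j != i)) mulr0.
Qed.

Lemma trepK p : 'X %| p -> 'X^(n.+1) %| tpoly (trep p) - p.
Proof.
move=> p0; apply/dvdpXnP => -[_|i lt_in].
  by rewrite coefB !dvdpX_coef0 ?subr0 // dvdpX_tpoly.
by rewrite coefB (coef_tpoly _ (Ordinal (lt_in : i < n)%N)) mxE subrr.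
Qed.

Lemma tpoly_inj_mod u v : 'X^(n.+1) %| tpoly u - tpoly v -> u = v.
Proof.
move=> uv; apply/rowP => i; rewrite -!coef_tpoly.
by apply: coef_eq_mod uv _; rewrite ltnS.
Qed.

Lemma inv_tpolyP : 'X^(n.+1) %| E * (1 + tpoly y) - 1.
Proof.
have := congr1 (fun p => p \Po tpoly y) (geom_polyM R n).
rewrite rmorphM rmorphD rmorphB rmorphXn rmorphN /= !comp_polyX !rmorph1 => ->.
by rewrite addrAC subrr add0r dvdpNr exprNn dvdp_mull // dvdp_exp2r // dvdpX_tpoly.
Qed.

(** The second derivative of [log_poly] is known only modulo s^n, but the two monomials supply at
    least t^2, so the error starts at t^(n+2), beyond the coefficient read. *)
Lemma affine_form_mxE (i j : 'I_n) :
  affine_form_mx F y i j = ('X^(i.+1) * 'X^(j.+1) * E ^+ 2)`_n.+1.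
Proof.
rewrite mxE cayley_functionE !partial_coef_comp mul1r.
apply: (@coef_eq_mod _ (2 + n)) => //; rewrite -mulrBr -rmorphXn -rmorphB /= exprD.
apply: dvdp_mul; first by rewrite -exprD dvdp_exp2l // addSn addnS.
by rewrite dvdp_Xn_comp ?dvdpX_tpoly // log_poly_deriv2.
Qed.

Lemma cubic_formE (i j k : 'I_n) :
  cubic_form F y i j k = - 2 * ('X^(i.+1) * 'X^(j.+1) * 'X^(k.+1) * E ^+ 3)`_n.+1.
Proof.
rewrite /cubic_form cayley_functionE !partial_coef_comp mul1r -coefZ.
(* Same count of orders: three from the monomials, [n.-1] from the third derivative of
   [log_poly]. *)
apply: (@coef_eq_mod _ (3 + n.-1)); last by case: (n) i => // -[].
rewrite scalerAr -mulrBr -mul_polyC -rmorphXn -(comp_polyC _ (tpoly y)).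
rewrite -rmorphM -rmorphB /= exprD; apply: dvdp_mul.
  by rewrite -!exprD dvdp_exp2l // !(addSn, addnS).
rewrite dvdp_Xn_comp ?dvdpX_tpoly // rmorphN mulNr opprK rmorph_nat.
exact: log_poly_deriv3.
Qed.

Lemma affine_formE u v :
  affine_form F y u v = (tpoly u * tpoly v * E ^+ 2)`_n.+1.
Proof.
rewrite -[tpoly u]mul1r -[_ * _ * E ^+ 2]mulrA (coef_mul_tpoly _ _ _ u).
apply: eq_bigr => i _; rewrite mul1r mulrA (coef_mul_tpoly _ _ _ v) mulr_sumr.
by apply: eq_bigr => j _; rewrite affine_form_mxE; ring.
Qed.

Lemma cubic_contraction u v (k : 'I_n) :
  \sum_(i < n) \sum_(j < n) cubic_form F y i j k * u 0 i * v 0 j =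
  - 2 * (tpoly u * tpoly v * 'X^(k.+1) * E ^+ 3)`_n.+1.
Proof.
rewrite -[tpoly u]mul1r -2!mulrA (coef_mul_tpoly _ _ _ u) mulr_sumr.
apply: eq_bigr => i _; rewrite mul1r mulrA (coef_mul_tpoly _ _ _ v) !mulr_sumr.
by apply: eq_bigr => j _; rewrite cubic_formE !mulrA; ring.
Qed.

Lemma affine_form_mx_sym : (affine_form_mx F y)^T = affine_form_mx F y.
Proof. by apply/matrixP => i j; rewrite mxE !affine_form_mxE ['X^_ * _]mulrC. Qed.

Lemma affine_form_mulmx u v :
  affine_form F y u v = (u *m affine_form_mx F y *m v^T) 0 0.
Proof.
rewrite mxE /affine_form exchange_big; apply: eq_bigr => j _.
rewrite !mxE mulr_suml; apply: eq_bigr => i _.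
by rewrite [u 0 i * _]mulrC.
Qed.

Lemma affine_form_sym u v : affine_form F y u v = affine_form F y v u.
Proof. by rewrite !affine_formE [tpoly u * _]mulrC. Qed.

(** [trepK] holds only modulo t^(n+1), yet coefficient n + 1 is safe because [tpoly u] brings
    another factor t. *)
Lemma affine_form_trep u p : 'X %| p ->
  affine_form F y u (trep p) = (tpoly u * p * E ^+ 2)`_n.+1.
Proof.
move=> p0; rewrite affine_formE; apply: (@coef_eq_mod _ n.+2) => //.
rewrite -mulrBl -mulrBr dvdp_mulr // exprS dvdp_mul ?dvdpX_tpoly //.
exact: trepK.
Qed.

Lemma affine_form_nondegenerate u :
  (forall v, affine_form F y u v = 0) -> u = 0.
Proof.
move=> u0; apply/rowP => i; rewrite mxE -coef_tpoly.
(* The square cancels the weight [E ^+ 2], and the shift by n - i moves the coefficient of t^(i+1)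
   in [tpoly u] to t^(n+1). Since i < n, this is a multiple of t. *)
pose p : {poly R} := 'X^(n - i) * (1 + tpoly y) ^+ 2.
have Xp : 'X %| p.
  by rewrite dvdp_mulr // -(@prednK (n - i)) ?subn_gt0 // exprS dvdp_mulr.
rewrite -[RHS](u0 (trep p)) affine_form_trep //.
transitivity (tpoly u * 'X^(n - i))`_n.+1.
  rewrite coefMXn ltnNge leqW ?leq_subr //=.
  by have -> : (n.+1 - (n - i))%N = i.+1 by rewrite subSn ?leq_subr // subKn // ltnW.
symmetry; apply: (@coef_eq_mod _ n.+2) => //.
rewrite (_ : _ - _ = tpoly u * ('X^(n - i) * (E * (1 + tpoly y) + 1)
   * (E * (1 + tpoly y) - 1))); last by rewrite /p; ring.
by rewrite exprS dvdp_mul ?dvdpX_tpoly // dvdp_mull // inv_tpolyP.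
Qed.

Lemma affine_form_mx_unit : affine_form_mx F y \in unitmx.
Proof.
rewrite -row_free_unit; apply: inj_row_free => u uH.
by apply: affine_form_nondegenerate => v; rewrite affine_form_mulmx uH mul0mx mxE.
Qed.

(** The inverse Hessian is never computed: the candidate [w] is multiplied by the Hessian H,
    compared with the contracted cubic form, and H is then cancelled. *)
Lemma difference_tensorE u v :
  difference_tensor F y u v = trep (tpoly u * tpoly v * E).
Proof.
set w := trep _; set H := affine_form_mx F y.
have XW : 'X %| tpoly u * tpoly v * E by rewrite !dvdp_mulr ?dvdpX_tpoly.
have symH : H^T = H by exact: affine_form_mx_sym.
have Hu : H \in unitmx by exact: affine_form_mx_unit.
have wH d : (w *m H) 0 d =
    - 2^-1 * \sum_(i < n) \sum_(j < n) cubic_form F y i j d * u 0 i * v 0 j.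
  have -> : (w *m H) 0 d = affine_form F y w (delta_mx 0 d).
    by rewrite affine_form_mulmx trmx_delta -colE [RHS]mxE.
  rewrite affine_form_sym affine_form_trep // tpoly_delta cubic_contraction.
  rewrite [RHS]mulrA mulrNN mulVf ?pnatr_eq0 // mul1r; congr (nth 0 (polyseq _) _).
  by ring.
rewrite -[RHS](mulmxK Hu); apply/rowP => c; rewrite !mxE.
(* Right multiplication by the inverse yields the indices in the order opposite to that in
   [difference_coef]. *)
have iH d : invmx H d c = invmx H c d.
  by rewrite -[in LHS]symH -trmx_inv mxE.
under [RHS]eq_bigr => d _ do rewrite wH iH mulr_sumr mulr_suml.
rewrite [RHS]exchange_big; apply: eq_bigr => a _ /=.
under [RHS]eq_bigr => d _ do rewrite mulr_sumr mulr_suml.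
rewrite [RHS]exchange_big; apply: eq_bigr => b _ /=.
rewrite /difference_coef mulr_sumr !mulr_suml; apply: eq_bigr => d _.
rewrite -/H; move: (cubic_form _ _ _ _ _) (invmx _ _ _) (- _) => C I k.
by rewrite !mulrA [LHS](ACl (1*2*4*5*3)).
Qed.

Definition cayley_iso u : {poly %/ ('X^(n.+1) : {poly R})} :=
  in_qpoly 'X^(n.+1) (tpoly u * E).

Lemma cayley_iso_linear : linear cayley_iso.
Proof. by move=> a u v; rewrite /cayley_iso linearP mulrDl -scalerAl linearP. Qed.

HB.instance Definition _ := GRing.isLinear.Build R 'rV[R]_n
  {poly %/ ('X^(n.+1) : {poly R})} _ cayley_iso cayley_iso_linear.

Lemma cayley_iso_trep p :
  'X %| p -> cayley_iso (trep p) = in_qpoly 'X^(n.+1) (p * E).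
Proof.
by move=> p0; apply/in_qpolyXn_eq; rewrite -mulrBl dvdp_mulr // trepK.
Qed.

Lemma cayley_iso_inj : injective cayley_iso.
Proof.
move=> u v /in_qpolyXn_eq uv; apply: tpoly_inj_mod.
(* Multiplication by 1 + X(t) undoes multiplication by [E], up to the error bounded in
   [inv_tpolyP]. *)
rewrite (_ : tpoly u - tpoly v = (tpoly u * E - tpoly v * E) * (1 + tpoly y)
   - (tpoly u - tpoly v) * (E * (1 + tpoly y) - 1)); last by ring.
by apply: dvdp_sub; [exact: dvdp_mulr | exact/dvdp_mull/inv_tpolyP].
Qed.

Lemma cayley_iso_image z : in_tquotient z <-> exists u, cayley_iso u = z.
Proof.
split=> [[p p0 ->]|[u <-]]; last first.
  by exists (tpoly u * E) => //; rewrite dvdp_mulr ?dvdpX_tpoly.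
exists (trep (p * (1 + tpoly y))); rewrite cayley_iso_trep ?dvdp_mulr //.
apply/in_qpolyXn_eq.
rewrite (_ : _ - p = p * (E * (1 + tpoly y) - 1)); last by ring.
by rewrite dvdp_mull ?inv_tpolyP.
Qed.

Lemma cayley_isoM u v :
  cayley_iso (difference_tensor F y u v) = cayley_iso u * cayley_iso v.
Proof.
rewrite difference_tensorE cayley_iso_trep ?dvdp_mulr ?dvdpX_tpoly //.
by rewrite /cayley_iso -in_qpolyM; congr in_qpoly; ring.
Qed.

(** The weight [E ^+ 2] splits between the two factors. Replacing either one changes it by a
    multiple of t^(n+1), and the other contributes a further t. *)
Lemma cayley_iso_form p q u v : 'X %| p -> 'X %| q ->
  cayley_iso u = tpoly_class n p -> cayley_iso v = tpoly_class n q ->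
  affine_form F y u v = (p * q)`_n.+1.
Proof.
move=> p0 q0 /in_qpolyXn_eq up /in_qpolyXn_eq vq; rewrite affine_formE.
apply: (@coef_eq_mod _ n.+2) => //.
rewrite (_ : _ - _ = (tpoly u * E - p) * (tpoly v * E)
  + (tpoly v * E - q) * p); last by ring.
by rewrite exprSr; apply: dvdp_add; apply: dvdp_mul; rewrite ?dvdp_mulr ?dvdpX_tpoly.
Qed.

(** The laws of the product are pulled back along the injection [cayley_iso] from a commutative
    associative ring. In the trace identity both sides are the coefficient of t^(n+1) in U V W
    E^3. *)
Lemma cayley_metrised_jordan_algebra :
  metrised_jordan_algebra (difference_tensor F y) (affine_form F y).
Proof.
split.
- move=> u a v w; apply: cayley_iso_inj.
  by rewrite cayley_isoM !linearP mulrDr -scalerAr /= !cayley_isoM.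
- by move=> u v; apply: cayley_iso_inj; rewrite !cayley_isoM mulrC.
- by move=> u v; apply: cayley_iso_inj; rewrite !cayley_isoM mulrA.
- move=> u a v w; rewrite !affine_formE.
  by rewrite linearP mulrDr mulrDl -scalerAr -scalerAl coefD coefZ.
- exact: affine_form_sym.
- exact: affine_form_nondegenerate.
- move=> u v w; rewrite !difference_tensorE affine_form_sym.
  rewrite !affine_form_trep ?dvdp_mulr ?dvdpX_tpoly //.
  by congr (nth 0 (polyseq _) _); ring.
Qed.

End CayleyAlgebra.

Theorem theorem5p11 (R : realType) (n : nat) (y : 'rV[R]_n) :
  let F : 'rV[R]_n -> R := @cayley_function R n in
  let mul : 'rV[R]_n -> 'rV[R]_n -> 'rV[R]_n := difference_tensor F y in
  let gamma : 'rV[R]_n -> 'rV[R]_n -> R := affine_form F y in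
  metrised_jordan_algebra mul gamma /\
  exists phi : {linear 'rV[R]_n -> {poly %/ ('X^(n.+1) : {poly R})}},
    [/\ injective phi,
        (forall z, in_tquotient z <-> exists u, phi u = z),
        (forall u v, phi (mul u v) = phi u * phi v)
      & (forall (p q : {poly R}) (u v : 'rV[R]_n),
          'X %| p -> 'X %| q ->
          phi u = tpoly_class n p -> phi v = tpoly_class n q ->
          gamma u v = (p * q)`_n.+1)].
Proof.
split; first exact: cayley_metrised_jordan_algebra.
exists (cayley_iso y); split.
- exact: cayley_iso_inj.
- exact: cayley_iso_image.
- exact: cayley_isoM.
- by move=> p q u v; exact: cayley_iso_form.
Qed.
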